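(* Let $(A,\cdot,\Delta_A)$ be a left-symmetric bialgebra, $V$ a vector space, and let linear maps $\triangleright:A\otimes V\to V$, $\triangleleft:V\otimes A\to V$, $\theta:A\otimes A\to V$, $\cdot_V:V\otimes V\to V$ (written $xy$), $\phi:A\to V\otimes A$, $\psi:A\to A\otimes V$, $\rho:V\to A\otimes V$, $\gamma:V\to V\otimes A$, $P:A\to V\otimes V$, $\Delta_V:V\to V\otimes V$ be given. On $E=A\oplus V$ consider the product $$(a,x)(b,y)=(ab,\;xy+a\triangleright y+x\triangleleft b+\theta(a,b))$$ and coproduct $\Delta_E(a)=\Delta_A(a)+\phi(a)+\psi(a)+P(a)$, $\Delta_E(x)=\Delta_V(x)+\rho(x)+\gamma(x)$. Then $E$ is a left-symmetric bialgebra if and only if $E$ with this product is a left-symmetric algebra, $E$ with this coproduct is a left-symmetric coalgebra, and for all $a,b\in A$, $x,y\in V$: 1. $\phi([a,b])+\gamma(\theta(a,b)-\theta(b,a))=a_{(-1)}\otimes[a_{(0)},b]+(a\triangleright b_{(-1)})\otimes b_{(0)}+\theta(a,b_1)\otimes b_2+b_{(-1)}\otimes[a,b_{(0)}]-(b\triangleright a_{(-1)})\otimes a_{(0)}-\theta(b,a_1)\otimes a_2$; 2. $\psi([a,b])+\rho(\theta(a,b)-\theta(b,a))=ab_{(0)}\otimes b_{(1)}+a_{(0)}\otimes(a_{(1)}\triangleleft b)+a_1\otimes\theta(a_2,b)+b_{(0)}\otimes(a\triangleright b_{(1)})+b_1\otimes\theta(a,b_2)-ba_{(0)}\otimes a_{(1)}-b_{(0)}\otimes(b_{(1)}\triangleleft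 a)-b_1\otimes\theta(b_2,a)-a_{(0)}\otimes(b\triangleright a_{(1)})-a_1\otimes\theta(b,a_2)$; 3. $\rho([x,y])=x_{[-1]}\otimes[x_{[0]},y]+y_{[-1]}\otimes[x,y_{[0]}]$; 4. $\gamma([x,y])=xy_{[0]}\otimes y_{[1]}-yx_{[0]}\otimes x_{[1]}$; 5. $\Delta_V(a\triangleright y)-\Delta_V(y\triangleleft a)=a_{(-1)}\otimes(a_{(0)}\triangleright y)+(a\triangleright y_1)\otimes y_2+a_{\langle1\rangle}\otimes[a_{\langle2\rangle},y]+\theta(a,y_{[-1]})\otimes y_{[0]}+y_1\otimes(a\triangleright y_2)+y_{[0]}\otimes\theta(a,y_{[1]})-y_1\otimes(y_2\triangleleft a)-(y\triangleleft a_{(0)})\otimes a_{(1)}-y_{[0]}\otimes\theta(y_{[1]},a)-ya_{\langle1\rangle}\otimes a_{\langle2\rangle}-a_{(-1)}\otimes(y\triangleleft a_{(0)})$; 6. $\Delta_V(\theta(a,b)-\theta(b,a))+P([a,b])=a_{(-1)}\otimes\theta(a_{(0)},b)+a_{\langle1\rangle}\otimes(a_{\langle2\rangle}\triangleleft b)+\theta(a,b_{(0)})\otimes b_{(1)}+(a\triangleright b_{\langle1\rangle})\otimes b_{\langle2\rangle}+b_{(-1)}\otimes\theta(a,b_{(0)})+b_{\langle1\rangle}\otimes(a\triangleright b_{\langle2\rangle})-b_{(-1)}\otimes\theta(b_{(0)},a)-b_{\langle1\rangle}\otimes(b_{\langle2\rangle}\triangleleft a)-\theta(b,a_{(0)})\otimes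 a_{(1)}-(b\triangleright a_{\langle1\rangle})\otimes a_{\langle2\rangle}-a_{(-1)}\otimes\theta(b,a_{(0)})-a_{\langle1\rangle}\otimes(b\triangleright a_{\langle2\rangle})$; 7. $\gamma(x\triangleleft b)-\gamma(b\triangleright x)=xb_{(-1)}\otimes b_{(0)}+x_{[0]}\otimes[x_{[1]},b]+(x\triangleleft b_1)\otimes b_2-(b\triangleright x_{[0]})\otimes x_{[1]}$; 8. $\rho(x\triangleleft b)-\rho(b\triangleright x)=x_{[-1]}\otimes(x_{[0]}\triangleleft b)+b_1\otimes(x\triangleleft b_2)+b_{(0)}\otimes[x,b_{(1)}]-b_1\otimes(b_2\triangleright x)-bx_{[-1]}\otimes x_{[0]}-x_{[-1]}\otimes(b\triangleright x_{[0]})$; 9. $\phi(ab)+\gamma(\theta(a,b))-\tau\psi(ab)-\tau\rho(\theta(a,b))=a_{(-1)}\otimes a_{(0)}b+(a\triangleright b_{(-1)})\otimes b_{(0)}+\theta(a,b_1)\otimes b_2+b_{(-1)}\otimes ab_{(0)}-\tau\big(ab_{(0)}\otimes b_{(1)}+a_{(0)}\otimes(a_{(1)}\triangleleft b)+a_1\otimes\theta(a_2,b)+b_{(0)}\otimes(a\triangleright b_{(1)})+b_1\otimes\theta(a,b_2)\big)$; 10. $\rho(xy)-\tau\gamma(xy)=x_{[-1]}\otimes x_{[0]}y+y_{[-1]}\otimes xy_{[0]}-y_{[1]}\otimes xy_{[0]}$; 11. $(\mathrm{id}-\tau)\Delta_V(a\triangleright y)=(\mathrm{id}-\tau)\big(a_{(-1)}\otimes(a_{(0)}\triangleright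 y)+(a\triangleright y_1)\otimes y_2+a_{\langle1\rangle}\otimes a_{\langle2\rangle}y+\theta(a,y_{[-1]})\otimes y_{[0]}+y_1\otimes(a\triangleright y_2)+y_{[0]}\otimes\theta(a,y_{[1]})\big)$; 12. $(\mathrm{id}-\tau)\Delta_V(x\triangleleft b)=(\mathrm{id}-\tau)\big(x_1\otimes(x_2\triangleleft b)+(x\triangleleft b_{(0)})\otimes b_{(1)}+x_{[0]}\otimes\theta(x_{[1]},b)+xb_{\langle1\rangle}\otimes b_{\langle2\rangle}+b_{\langle1\rangle}\otimes xb_{\langle2\rangle}+b_{(-1)}\otimes(x\triangleleft b_{(0)})\big)$; 13. $(\mathrm{id}-\tau)(\Delta_V(\theta(a,b))+P(ab))=(\mathrm{id}-\tau)\big(a_{(-1)}\otimes\theta(a_{(0)},b)+a_{\langle1\rangle}\otimes(a_{\langle2\rangle}\triangleleft b)+\theta(a,b_{(0)})\otimes b_{(1)}+(a\triangleright b_{\langle1\rangle})\otimes b_{\langle2\rangle}+b_{(-1)}\otimes\theta(a,b_{(0)})+b_{\langle1\rangle}\otimes(a\triangleright b_{\langle2\rangle})\big)$; 14. $\gamma(x\triangleleft b)-\tau\rho(x\triangleleft b)=xb_{(-1)}\otimes b_{(0)}+x_{[0]}\otimes x_{[1]}b+(x\triangleleft b_1)\otimes b_2-(x_{[0]}\triangleleft b)\otimes x_{[-1]}-(x\triangleleft b_2)\otimes b_1-xb_{(1)}\otimes b_{(0)}$; 15. $\rho(a\triangleright y)-\tau\gamma(a\triangleright y)=a_{(0)}\otimes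 a_{(1)}y+a_1\otimes(a_2\triangleright y)+ay_{[-1]}\otimes y_{[0]}+y_{[-1]}\otimes(a\triangleright y_{[0]})-\tau\big((a\triangleright y_{[0]})\otimes y_{[1]}+y_{[0]}\otimes ay_{[1]}\big)$; 16. $\Delta_V([x,y])=x_1\otimes[x_2,y]+xy_1\otimes y_2-yx_1\otimes x_2-y_1\otimes[y_2,x]+x_{[0]}\otimes(x_{[1]}\triangleright y)+(x\triangleleft y_{[-1]})\otimes y_{[0]}+y_{[0]}\otimes(x\triangleleft y_{[1]})-y_{[0]}\otimes(y_{[1]}\triangleright x)-(y\triangleleft x_{[-1]})\otimes x_{[0]}-x_{[0]}\otimes(y\triangleleft x_{[1]})$; 17. $(\mathrm{id}-\tau)\Delta_V(xy)=(\mathrm{id}-\tau)\big(x_1\otimes x_2y+xy_1\otimes y_2+y_1\otimes xy_2+x_{[0]}\otimes(x_{[1]}\triangleright y)+(x\triangleleft y_{[-1]})\otimes y_{[0]}+y_{[0]}\otimes(x\triangleleft y_{[1]})\big)$. Conversely, any left-symmetric bialgebra structure on $E=A\oplus V$ for which the canonical projection $p:E\to A$, $(a,x)\mapsto a$, is both a left-symmetric algebra homomorphism and a left-symmetric coalgebra homomorphism is of this form.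
   Context: All vector spaces are over a fixed field of characteristic zero. $\tau(u\otimes v)=v\otimes u$, $\tau_{12}(u\otimes v\otimes w)=v\otimes u\otimes w$, $[a,b]:=ab-ba$. A left-symmetric algebra has a bilinear product with $(ab)c-a(bc)=(ba)c-b(ac)$. A left-symmetric coalgebra has a linear coproduct $\Delta$ with $(\Delta\otimes\mathrm{id})\Delta(c)-(\mathrm{id}\otimes\Delta)\Delta(c)$ fixed by $\tau_{12}$. A left-symmetric bialgebra is both, with $\Delta([a,b])=ab_1\otimes b_2+b_1\otimes[a,b_2]-ba_1\otimes a_2-a_1\otimes[b,a_2]$ and $(\mathrm{id}-\tau)\Delta(ab)=(\mathrm{id}-\tau)(a_1\otimes a_2b+ab_1\otimes b_2+b_1\otimes ab_2)$. Summation-suppressed notation: $\Delta_A(a)=a_1\otimes a_2$, $\Delta_V(x)=x_1\otimes x_2$, $\phi(a)=a_{(-1)}\otimes a_{(0)}$, $\psi(a)=a_{(0)}\otimes a_{(1)}$, $\rho(x)=x_{[-1]}\otimes x_{[0]}$, $\gamma(x)=x_{[0]}\otimes x_{[1]}$, $P(a)=a_{\langle1\rangle}\otimes a_{\langle2\rangle}$; $[x,y]=xy-yx$ for $x,y\in V$. *)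

(* Defs.v *)
From HB Require Import structures.
From mathcomp Require Import all_boot all_algebra.
From mathcomp Require Import boolp.

Set Implicit Arguments.
Unset Strict Implicit.
Unset Printing Implicit Defensive.

Import GRing.Theory.
Local Open Scope ring_scope.
Local Open Scope quotient_scope.

Reserved Notation "U ⊗ V" (at level 45, left associativity).
Reserved Notation "\tsum_ ( u , v <- t ) F"
  (at level 46, F at level 46, u name, v name, t at level 99,
   format "\tsum_ ( u ,  v  <-  t )  F").

Definition bilinear_map (F : fieldType) (U V W : lmodType F)
    (f : U -> V -> W) : Prop :=
  (forall v, linear (fun u => f u v)) /\ (forall u, linear (f u)).

(* The tensor product of two vector spaces, as formal finite sums
   u_1 ⊗ v_1 + ... + u_n ⊗ v_n (represented by the sequence of the pairs
   (u_i, v_i)) modulo the congruence generated by commutativity of + and by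
   bilinearity of ⊗.  A scalar c acts by (u, v) |-> (c *: u, v), so no
   coefficients are needed in the formal sums; tens_eq_0l makes the empty sum
   the zero vector.  The universal property is given by tens_bilinear, tsum_tens,
   tsum_linear and tensor_span below. *)
Inductive tens_eq (F : fieldType) (U V : lmodType F) :
    seq (U * V) -> seq (U * V) -> Prop :=
| tens_eq_refl s : tens_eq s s
| tens_eq_sym s t : tens_eq s t -> tens_eq t s
| tens_eq_trans t s r : tens_eq s t -> tens_eq t r -> tens_eq s r
| tens_eq_cat s1 t1 s2 t2 :
    tens_eq s1 t1 -> tens_eq s2 t2 -> tens_eq (s1 ++ s2) (t1 ++ t2)
| tens_eq_catC s t : tens_eq (s ++ t) (t ++ s)
| tens_eq_0l v : tens_eq [:: (0, v)] [::]
| tens_eq_Dl u u' v : tens_eq [:: (u + u', v)] [:: (u, v); (u', v)]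
| tens_eq_Dr u v v' : tens_eq [:: (u, v + v')] [:: (u, v); (u, v')]
| tens_eq_Z c u v : tens_eq [:: (c *: u, v)] [:: (u, c *: v)].

Section Tensor.
Variables (F : fieldType) (U V : lmodType F).

Definition tens_rel : rel (seq (U * V)) := fun s t => `[< tens_eq s t >].

Lemma tens_rel_equiv : equiv_class_of tens_rel.
Proof.
split=> [s|s t|t s r].
- exact/asboolP/tens_eq_refl.
- by apply/asboolP/asboolP; apply: tens_eq_sym.
- by move=> /asboolP st /asboolP tr; apply/asboolP; apply: tens_eq_trans st tr.
Qed.

Canonical tens_equiv := EquivRelPack tens_rel_equiv.

Definition tensor : Type := {eq_quot tens_equiv}.
HB.instance Definition _ := Choice.on tensor.
HB.instance Definition _ := Quotient.on tensor.

Lemma tensor_eqP (s t : seq (U * V)) :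
  tens_eq s t <-> \pi_tensor s = \pi_tensor t.
Proof.
split=> [st|/eqmodP /asboolP //].
by apply/eqmodP/asboolP.
Qed.

Lemma repr_tens_eq s : tens_eq (repr (\pi_tensor s)) s.
Proof. by apply/tensor_eqP; rewrite reprK. Qed.

Definition tens_scale_seq (c : F) (s : seq (U * V)) : seq (U * V) :=
  [seq (c *: p.1, p.2) | p <- s].

Definition tens_zero : tensor := \pi_tensor [::].
Definition tens_add (x y : tensor) : tensor := \pi_tensor (repr x ++ repr y).
Definition tens_scale (c : F) (x : tensor) : tensor :=
  \pi_tensor (tens_scale_seq c (repr x)).
Definition tens_opp (x : tensor) : tensor := tens_scale (-1) x.

Lemma tens_eq_scale c s t :
  tens_eq s t -> tens_eq (tens_scale_seq c s) (tens_scale_seq c t).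
Proof.
elim=> {s t} /=.
- by move=> s; apply: tens_eq_refl.
- by move=> s t _; apply: tens_eq_sym.
- by move=> t s r _ st _; apply: tens_eq_trans.
- move=> s1 t1 s2 t2 _ H1 _ H2; rewrite /tens_scale_seq !map_cat.
  exact: tens_eq_cat.
- by move=> s t; rewrite /tens_scale_seq !map_cat; apply: tens_eq_catC.
- by move=> v; rewrite scaler0; apply: tens_eq_0l.
- by move=> u u' v; rewrite scalerDr; apply: tens_eq_Dl.
- by move=> u v v'; apply: tens_eq_Dr.
- by move=> d u v; rewrite scalerA mulrC -scalerA; apply: tens_eq_Z.
Qed.

Lemma tens_addE s t :
  tens_add (\pi s) (\pi t) = \pi_tensor (s ++ t).
Proof. by apply/tensor_eqP/tens_eq_cat; apply: repr_tens_eq. Qed.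

Lemma tens_scaleE c s :
  tens_scale c (\pi s) = \pi_tensor (tens_scale_seq c s).
Proof. by apply/tensor_eqP/tens_eq_scale/repr_tens_eq. Qed.

Lemma tens_addA : associative tens_add.
Proof.
by elim/quotW=> x; elim/quotW=> y; elim/quotW=> z; rewrite !tens_addE catA.
Qed.

Lemma tens_addC : commutative tens_add.
Proof.
elim/quotW=> x; elim/quotW=> y; rewrite !tens_addE.
exact/tensor_eqP/tens_eq_catC.
Qed.

Lemma tens_add0 : left_id tens_zero tens_add.
Proof. by elim/quotW=> x; rewrite tens_addE. Qed.

Lemma tens_eq_scaleD c d s :
  tens_eq (tens_scale_seq (c + d) s) (tens_scale_seq c s ++ tens_scale_seq d s).
Proof.
elim: s => [|[u v] s IHs] /=; first exact: tens_eq_refl.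
rewrite scalerDl -cat1s.
apply: (tens_eq_trans (tens_eq_cat (tens_eq_Dl _ _ _) IHs)) => /=.
set C := tens_scale_seq c s; set D := tens_scale_seq d s.
change (tens_eq ([:: (c *: u, v)] ++ ([:: (d *: u, v)] ++ C) ++ D)
                ([:: (c *: u, v)] ++ (C ++ [:: (d *: u, v)] ++ D))).
rewrite (catA C); apply: tens_eq_cat; first exact: tens_eq_refl.
apply: tens_eq_cat; last exact: tens_eq_refl.
exact: tens_eq_catC.
Qed.

Lemma tens_eq_scale0 s : tens_eq (tens_scale_seq 0 s) [::].
Proof.
elim: s => [|[u v] s IHs] /=; first exact: tens_eq_refl.
by rewrite scale0r; exact (tens_eq_cat (tens_eq_0l U v) IHs).
Qed.

Lemma tens_scale1 : left_id 1 tens_scale.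
Proof.
elim/quotW=> x; rewrite tens_scaleE; congr \pi.
rewrite /tens_scale_seq -[RHS]map_id.
by apply: eq_map => -[u v]; rewrite scale1r.
Qed.

Lemma tens_scaleDl x : {morph tens_scale^~ x : c d / c + d >-> tens_add c d}.
Proof.
move=> c d; elim/quotW: x => x; rewrite !tens_scaleE tens_addE.
exact/tensor_eqP/tens_eq_scaleD.
Qed.

Lemma tens_addN : left_inverse tens_zero tens_opp tens_add.
Proof.
elim/quotW=> x; rewrite /tens_opp -[X in tens_add _ X]tens_scale1.
rewrite -tens_scaleDl addNr tens_scaleE.
exact/tensor_eqP/tens_eq_scale0.
Qed.

HB.instance Definition _ :=
  GRing.isZmodule.Build tensor tens_addA tens_addC tens_add0 tens_addN.

Lemma tens_scaleA c d x : tens_scale c (tens_scale d x) = tens_scale (c * d) x.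
Proof.
elim/quotW: x => x; rewrite !tens_scaleE /tens_scale_seq -map_comp; congr \pi.
by apply: eq_map => -[u v] /=; rewrite scalerA.
Qed.

Lemma tens_scaleDr : right_distributive tens_scale +%R.
Proof.
move=> c; elim/quotW=> x; elim/quotW=> y; rewrite [_ + _]tens_addE.
by rewrite !tens_scaleE /tens_scale_seq map_cat -tens_addE.
Qed.

HB.instance Definition _ :=
  GRing.Zmodule_isLmodule.Build F tensor
    tens_scaleA tens_scale1 tens_scaleDr tens_scaleDl.

Definition tens (u : U) (v : V) : tensor := \pi_tensor [:: (u, v)].

End Tensor.

Notation "U ⊗ V" := (tensor U V) : type_scope.
Notation "u ⊗ v" := (tens u v) : ring_scope.

(* Sweedler notation: for t = u_1 ⊗ v_1 + ... + u_n ⊗ v_n,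
   \tsum_(u, v <- t) f u v is the sum of the f u_i v_i.  It is computed on a
   chosen representative of t; when f is bilinear in (u, v), which is the case
   in every use below, tsum f is the linear map induced by f (see tsum_linear
   and tsum_tens), so the choice is irrelevant. *)
Definition tsum (F : fieldType) (U V W : lmodType F) (f : U -> V -> W)
    (t : (U ⊗ V)%type) : W :=
  \sum_(p <- repr t) f p.1 p.2.

Notation "\tsum_ ( u , v <- t ) F" := (tsum (fun u v => F) t) : ring_scope.

Section TensorTheory.
Variables (F : fieldType) (U V W : lmodType F).

Lemma tens_bilinear : bilinear_map (@tens F U V).
Proof.
have tensD s t : \pi_(tensor U V) (s ++ t)
    = \pi_(tensor U V) s + \pi_(tensor U V) t :> tensor U V.
  by rewrite [RHS]tens_addE.
have tensZ c u v : c *: (u ⊗ v) = \pi_(tensor U V) [:: (c *: u, v)].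
  by rewrite [LHS]tens_scaleE.
split=> [v c u u'|u c v v'].
  rewrite tensZ -tensD; exact/tensor_eqP/tens_eq_Dl.
rewrite tensZ -tensD; apply/tensor_eqP.
apply: tens_eq_trans (tens_eq_Dr _ _ _) _.
apply: (@tens_eq_cat _ _ _ [:: _] [:: _] [:: _] [:: _]).
  exact/tens_eq_sym/tens_eq_Z.
exact: tens_eq_refl.
Qed.

Lemma tensor_repr (t : (U ⊗ V)%type) : t = \sum_(p <- repr t) (p.1 ⊗ p.2).
Proof.
rewrite -{1}[t]reprK; elim: (repr t) => [|[u v] s IHs].
  by rewrite big_nil.
by rewrite big_cons -IHs [RHS]tens_addE.
Qed.

Lemma tsum_pi (f : U -> V -> W) (s : seq (U * V)) :
  bilinear_map f -> tsum f (\pi s) = \sum_(p <- s) f p.1 p.2.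
Proof.
move=> [fl fr].
have fDl u u' v : f (u + u') v = f u v + f u' v.
  by have /= := fl v 1 u u'; rewrite !scale1r.
have fDr u v v' : f u (v + v') = f u v + f u v'.
  by have /= := fr u 1 v v'; rewrite !scale1r.
have f0l v : f 0 v = 0.
  by apply: (addrI (f 0 v)); rewrite -fDl !addr0.
have f0r u : f u 0 = 0.
  by apply: (addrI (f u 0)); rewrite -fDr !addr0.
have fZl c u v : f (c *: u) v = c *: f u v.
  by have := fl v c u 0; rewrite f0l !addr0.
have fZr c u v : f u (c *: v) = c *: f u v.
  by have := fr u c v 0; rewrite f0r !addr0.
rewrite /tsum; move: (repr_tens_eq s); move: (repr _) => t.
elim=> {s t} //.
- by move=> s t r _ -> _ ->.
- by move=> s1 t1 s2 t2 _ E1 _ E2; rewrite !big_cat E1 E2.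
- by move=> s t; rewrite !big_cat /= addrC.
- by move=> v; rewrite big_seq1 big_nil f0l.
- by move=> u u' v; rewrite !big_cons !big_nil !addr0 /= fDl.
- by move=> u v v'; rewrite !big_cons !big_nil !addr0 /= fDr.
- by move=> c u v; rewrite !big_seq1 /= fZl fZr.
Qed.

Lemma tsum_tens (f : U -> V -> W) u v : bilinear_map f -> tsum f (u ⊗ v) = f u v.
Proof. by move=> fb; rewrite tsum_pi // big_seq1. Qed.

Lemma tsum_linear (f : U -> V -> W) : bilinear_map f -> linear (tsum f).
Proof.
move=> fb c; elim/quotW=> s; elim/quotW=> t.
rewrite [_ *: _]tens_scaleE [_ + _]tens_addE !tsum_pi // big_cat; congr (_ + _).
rewrite big_map scaler_sumr; apply: eq_bigr => -[u v] _ /=.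
case: fb => fl _.
have f0 : f 0 v = 0.
  apply: (addrI (f 0 v)); rewrite addr0.
  by have /= := fl v 1 0 0; rewrite !scale1r addr0.
by have := fl v c u 0; rewrite f0 !addr0.
Qed.

Lemma tensor_span (g h : {linear (U ⊗ V)%type -> W}) :
  (forall u v, g (u ⊗ v) = h (u ⊗ v)) -> g =1 h.
Proof.
move=> gh t; rewrite [t]tensor_repr !raddf_sum.
by apply: eq_bigr => p _; apply: gh.
Qed.

End TensorTheory.

Section TensorMaps.
Variable F : fieldType.

Definition tmap (U V U' V' : lmodType F) (f : U -> U') (g : V -> V')
    (t : (U ⊗ V)%type) : (U' ⊗ V')%type :=
  \tsum_(u, v <- t) f u ⊗ g v.

Definition tau (U V : lmodType F) (t : (U ⊗ V)%type) : (V ⊗ U)%type :=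
  \tsum_(u, v <- t) v ⊗ u.

Definition tassoc (U V W : lmodType F) (t : (U ⊗ (V ⊗ W))%type) :
    (U ⊗ V ⊗ W)%type :=
  \tsum_(u, s <- t) \tsum_(v, w <- s) u ⊗ v ⊗ w.

Definition tau12 (U V W : lmodType F) (t : (U ⊗ V ⊗ W)%type) :
    (V ⊗ U ⊗ W)%type :=
  tmap (@tau U V) id t.

Definition antisym (U : lmodType F) (t : (U ⊗ U)%type) : (U ⊗ U)%type :=
  t - tau t.

End TensorMaps.

Section LeftSymmetric.
Variables (F : fieldType) (A : lmodType F).
Implicit Types (m : A -> A -> A) (D : A -> (A ⊗ A)%type).

Definition commutator m (a b : A) : A := m a b - m b a.

Definition left_symmetric_algebra m : Prop :=
  bilinear_map m /\
  forall a b c, m (m a b) c - m a (m b c) = m (m b a) c - m b (m a c).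

Definition left_symmetric_coalgebra D : Prop :=
  linear D /\
  forall c, let d := tmap D id (D c) - tassoc (tmap id D (D c)) in tau12 d = d.

Definition left_symmetric_bialgebra m D : Prop :=
  [/\ left_symmetric_algebra m,
      left_symmetric_coalgebra D,
      forall a b, D (commutator m a b)
        = \tsum_(b1, b2 <- D b) m a b1 ⊗ b2
          + \tsum_(b1, b2 <- D b) b1 ⊗ commutator m a b2
          - \tsum_(a1, a2 <- D a) m b a1 ⊗ a2
          - \tsum_(a1, a2 <- D a) a1 ⊗ commutator m b a2
    & forall a b, antisym (D (m a b))
        = antisym (\tsum_(a1, a2 <- D a) a1 ⊗ m a2 b
                   + \tsum_(b1, b2 <- D b) m a b1 ⊗ b2
                   + \tsum_(b1, b2 <- D b) b1 ⊗ m a b2)].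

End LeftSymmetric.

Record extending_datum (F : fieldType) (A V : lmodType F) := ExtendingDatum {
  lact : {linear (A ⊗ V)%type -> V};            (* a ▷ x *)
  ract : {linear (V ⊗ A)%type -> V};            (* x ◁ a *)
  cocycle : {linear (A ⊗ A)%type -> V};         (* θ *)
  mulV : {linear (V ⊗ V)%type -> V};            (* x y *)
  phi : {linear A -> (V ⊗ A)%type};
  psi : {linear A -> (A ⊗ V)%type};
  rho : {linear V -> (A ⊗ V)%type};
  gamma : {linear V -> (V ⊗ A)%type};
  cococycle : {linear A -> (V ⊗ V)%type};       (* P *)
  DeltaV : {linear V -> (V ⊗ V)%type}
}.

Section Extending.
Variables (F : fieldType) (A V : lmodType F).
Variables (m : A -> A -> A) (D : A -> (A ⊗ A)%type).
Variable d : extending_datum A V.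

Local Notation "a · b" := (m a b) (at level 40, left associativity).
Local Notation "a ▷ x" := (lact d (a ⊗ x)) (at level 40, left associativity).
Local Notation "x ◁ a" := (ract d (x ⊗ a)) (at level 40, left associativity).
Local Notation "x ∘ y" := (mulV d (x ⊗ y)) (at level 40, left associativity).
Local Notation θ a b := (cocycle d (a ⊗ b)).
Local Notation φ := (phi d).
Local Notation ψ := (psi d).
Local Notation ρ := (rho d).
Local Notation γ := (gamma d).
Local Notation P := (cococycle d).
Local Notation ΔV := (DeltaV d).
Local Notation "[A a , b ]" := (a · b - b · a) (at level 0, a at level 99).
Local Notation "[V x , y ]" := (x ∘ y - y ∘ x) (at level 0, x at level 99).

Definition extended_mul (e f : A * V) : A * V :=
  (e.1 · f.1, e.2 ∘ f.2 + e.1 ▷ f.2 + e.2 ◁ f.1 + θ e.1 f.1).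

Definition inA (a : A) : A * V := (a, 0).
Definition inV (x : V) : A * V := (0, x).

Definition extended_comul (e : A * V) : ((A * V)%type ⊗ (A * V)%type)%type :=
  tmap inA inA (D e.1) + tmap inV inA (φ e.1)
  + tmap inA inV (ψ e.1) + tmap inV inV (P e.1)
  + (tmap inV inV (ΔV e.2) + tmap inA inV (ρ e.2) + tmap inV inA (γ e.2)).

(* For an element z of A or V, the two legs of its image under a coproduct or
   a coaction are written z1 and z2; in each sum the map after <- tells where
   they live. *)

Definition compat1 : Prop := forall a b : A,
  φ [A a, b] + γ (θ a b - θ b a)
  = \tsum_(a1, a2 <- φ a) a1 ⊗ [A a2, b]
    + \tsum_(b1, b2 <- φ b) (a ▷ b1) ⊗ b2
    + \tsum_(b1, b2 <- D b) θ a b1 ⊗ b2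
    + \tsum_(b1, b2 <- φ b) b1 ⊗ [A a, b2]
    - \tsum_(a1, a2 <- φ a) (b ▷ a1) ⊗ a2
    - \tsum_(a1, a2 <- D a) θ b a1 ⊗ a2.

Definition compat2 : Prop := forall a b : A,
  ψ [A a, b] + ρ (θ a b - θ b a)
  = \tsum_(b1, b2 <- ψ b) (a · b1) ⊗ b2
    + \tsum_(a1, a2 <- ψ a) a1 ⊗ (a2 ◁ b)
    + \tsum_(a1, a2 <- D a) a1 ⊗ θ a2 b
    + \tsum_(b1, b2 <- ψ b) b1 ⊗ (a ▷ b2)
    + \tsum_(b1, b2 <- D b) b1 ⊗ θ a b2
    - \tsum_(a1, a2 <- ψ a) (b · a1) ⊗ a2
    - \tsum_(b1, b2 <- ψ b) b1 ⊗ (b2 ◁ a)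
    - \tsum_(b1, b2 <- D b) b1 ⊗ θ b2 a
    - \tsum_(a1, a2 <- ψ a) a1 ⊗ (b ▷ a2)
    - \tsum_(a1, a2 <- D a) a1 ⊗ θ b a2.

Definition compat3 : Prop := forall x y : V,
  ρ [V x, y]
  = \tsum_(x1, x2 <- ρ x) x1 ⊗ [V x2, y]
    + \tsum_(y1, y2 <- ρ y) y1 ⊗ [V x, y2].

Definition compat4 : Prop := forall x y : V,
  γ [V x, y]
  = \tsum_(y1, y2 <- γ y) (x ∘ y1) ⊗ y2
    - \tsum_(x1, x2 <- γ x) (y ∘ x1) ⊗ x2.

Definition compat5 : Prop := forall (a : A) (y : V),
  ΔV (a ▷ y) - ΔV (y ◁ a)
  = \tsum_(a1, a2 <- φ a) a1 ⊗ (a2 ▷ y)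
    + \tsum_(y1, y2 <- ΔV y) (a ▷ y1) ⊗ y2
    + \tsum_(a1, a2 <- P a) a1 ⊗ [V a2, y]
    + \tsum_(y1, y2 <- ρ y) θ a y1 ⊗ y2
    + \tsum_(y1, y2 <- ΔV y) y1 ⊗ (a ▷ y2)
    + \tsum_(y1, y2 <- γ y) y1 ⊗ θ a y2
    - \tsum_(y1, y2 <- ΔV y) y1 ⊗ (y2 ◁ a)
    - \tsum_(a1, a2 <- ψ a) (y ◁ a1) ⊗ a2
    - \tsum_(y1, y2 <- γ y) y1 ⊗ θ y2 a
    - \tsum_(a1, a2 <- P a) (y ∘ a1) ⊗ a2
    - \tsum_(a1, a2 <- φ a) a1 ⊗ (y ◁ a2).

Definition compat6 : Prop := forall a b : A,
  ΔV (θ a b - θ b a) + P [A a, b]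
  = \tsum_(a1, a2 <- φ a) a1 ⊗ θ a2 b
    + \tsum_(a1, a2 <- P a) a1 ⊗ (a2 ◁ b)
    + \tsum_(b1, b2 <- ψ b) θ a b1 ⊗ b2
    + \tsum_(b1, b2 <- P b) (a ▷ b1) ⊗ b2
    + \tsum_(b1, b2 <- φ b) b1 ⊗ θ a b2
    + \tsum_(b1, b2 <- P b) b1 ⊗ (a ▷ b2)
    - \tsum_(b1, b2 <- φ b) b1 ⊗ θ b2 a
    - \tsum_(b1, b2 <- P b) b1 ⊗ (b2 ◁ a)
    - \tsum_(a1, a2 <- ψ a) θ b a1 ⊗ a2
    - \tsum_(a1, a2 <- P a) (b ▷ a1) ⊗ a2
    - \tsum_(a1, a2 <- φ a) a1 ⊗ θ b a2
    - \tsum_(a1, a2 <- P a) a1 ⊗ (b ▷ a2).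

Definition compat7 : Prop := forall (x : V) (b : A),
  γ (x ◁ b) - γ (b ▷ x)
  = \tsum_(b1, b2 <- φ b) (x ∘ b1) ⊗ b2
    + \tsum_(x1, x2 <- γ x) x1 ⊗ [A x2, b]
    + \tsum_(b1, b2 <- D b) (x ◁ b1) ⊗ b2
    - \tsum_(x1, x2 <- γ x) (b ▷ x1) ⊗ x2.

Definition compat8 : Prop := forall (x : V) (b : A),
  ρ (x ◁ b) - ρ (b ▷ x)
  = \tsum_(x1, x2 <- ρ x) x1 ⊗ (x2 ◁ b)
    + \tsum_(b1, b2 <- D b) b1 ⊗ (x ◁ b2)
    + \tsum_(b1, b2 <- ψ b) b1 ⊗ [V x, b2]
    - \tsum_(b1, b2 <- D b) b1 ⊗ (b2 ▷ x)
    - \tsum_(x1, x2 <- ρ x) (b · x1) ⊗ x2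
    - \tsum_(x1, x2 <- ρ x) x1 ⊗ (b ▷ x2).

Definition compat9 : Prop := forall a b : A,
  φ (a · b) + γ (θ a b) - tau (ψ (a · b)) - tau (ρ (θ a b))
  = \tsum_(a1, a2 <- φ a) a1 ⊗ (a2 · b)
    + \tsum_(b1, b2 <- φ b) (a ▷ b1) ⊗ b2
    + \tsum_(b1, b2 <- D b) θ a b1 ⊗ b2
    + \tsum_(b1, b2 <- φ b) b1 ⊗ (a · b2)
    - tau (\tsum_(b1, b2 <- ψ b) (a · b1) ⊗ b2
           + \tsum_(a1, a2 <- ψ a) a1 ⊗ (a2 ◁ b)
           + \tsum_(a1, a2 <- D a) a1 ⊗ θ a2 b
           + \tsum_(b1, b2 <- ψ b) b1 ⊗ (a ▷ b2)
           + \tsum_(b1, b2 <- D b) b1 ⊗ θ a b2).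

Definition compat10 : Prop := forall x y : V,
  ρ (x ∘ y) - tau (γ (x ∘ y))
  = \tsum_(x1, x2 <- ρ x) x1 ⊗ (x2 ∘ y)
    + \tsum_(y1, y2 <- ρ y) y1 ⊗ (x ∘ y2)
    - \tsum_(y1, y2 <- γ y) y2 ⊗ (x ∘ y1).

Definition compat11 : Prop := forall (a : A) (y : V),
  antisym (ΔV (a ▷ y))
  = antisym (\tsum_(a1, a2 <- φ a) a1 ⊗ (a2 ▷ y)
             + \tsum_(y1, y2 <- ΔV y) (a ▷ y1) ⊗ y2
             + \tsum_(a1, a2 <- P a) a1 ⊗ (a2 ∘ y)
             + \tsum_(y1, y2 <- ρ y) θ a y1 ⊗ y2
             + \tsum_(y1, y2 <- ΔV y) y1 ⊗ (a ▷ y2)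
             + \tsum_(y1, y2 <- γ y) y1 ⊗ θ a y2).

Definition compat12 : Prop := forall (x : V) (b : A),
  antisym (ΔV (x ◁ b))
  = antisym (\tsum_(x1, x2 <- ΔV x) x1 ⊗ (x2 ◁ b)
             + \tsum_(b1, b2 <- ψ b) (x ◁ b1) ⊗ b2
             + \tsum_(x1, x2 <- γ x) x1 ⊗ θ x2 b
             + \tsum_(b1, b2 <- P b) (x ∘ b1) ⊗ b2
             + \tsum_(b1, b2 <- P b) b1 ⊗ (x ∘ b2)
             + \tsum_(b1, b2 <- φ b) b1 ⊗ (x ◁ b2)).

Definition compat13 : Prop := forall a b : A,
  antisym (ΔV (θ a b) + P (a · b))
  = antisym (\tsum_(a1, a2 <- φ a) a1 ⊗ θ a2 b
             + \tsum_(a1, a2 <- P a) a1 ⊗ (a2 ◁ b)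
             + \tsum_(b1, b2 <- ψ b) θ a b1 ⊗ b2
             + \tsum_(b1, b2 <- P b) (a ▷ b1) ⊗ b2
             + \tsum_(b1, b2 <- φ b) b1 ⊗ θ a b2
             + \tsum_(b1, b2 <- P b) b1 ⊗ (a ▷ b2)).

Definition compat14 : Prop := forall (x : V) (b : A),
  γ (x ◁ b) - tau (ρ (x ◁ b))
  = \tsum_(b1, b2 <- φ b) (x ∘ b1) ⊗ b2
    + \tsum_(x1, x2 <- γ x) x1 ⊗ (x2 · b)
    + \tsum_(b1, b2 <- D b) (x ◁ b1) ⊗ b2
    - \tsum_(x1, x2 <- ρ x) (x2 ◁ b) ⊗ x1
    - \tsum_(b1, b2 <- D b) (x ◁ b2) ⊗ b1
    - \tsum_(b1, b2 <- ψ b) (x ∘ b2) ⊗ b1.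

Definition compat15 : Prop := forall (a : A) (y : V),
  ρ (a ▷ y) - tau (γ (a ▷ y))
  = \tsum_(a1, a2 <- ψ a) a1 ⊗ (a2 ∘ y)
    + \tsum_(a1, a2 <- D a) a1 ⊗ (a2 ▷ y)
    + \tsum_(y1, y2 <- ρ y) (a · y1) ⊗ y2
    + \tsum_(y1, y2 <- ρ y) y1 ⊗ (a ▷ y2)
    - tau (\tsum_(y1, y2 <- γ y) (a ▷ y1) ⊗ y2
           + \tsum_(y1, y2 <- γ y) y1 ⊗ (a · y2)).

Definition compat16 : Prop := forall x y : V,
  ΔV [V x, y]
  = \tsum_(x1, x2 <- ΔV x) x1 ⊗ [V x2, y]
    + \tsum_(y1, y2 <- ΔV y) (x ∘ y1) ⊗ y2
    - \tsum_(x1, x2 <- ΔV x) (y ∘ x1) ⊗ x2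
    - \tsum_(y1, y2 <- ΔV y) y1 ⊗ [V y2, x]
    + \tsum_(x1, x2 <- γ x) x1 ⊗ (x2 ▷ y)
    + \tsum_(y1, y2 <- ρ y) (x ◁ y1) ⊗ y2
    + \tsum_(y1, y2 <- γ y) y1 ⊗ (x ◁ y2)
    - \tsum_(y1, y2 <- γ y) y1 ⊗ (y2 ▷ x)
    - \tsum_(x1, x2 <- ρ x) (y ◁ x1) ⊗ x2
    - \tsum_(x1, x2 <- γ x) x1 ⊗ (y ◁ x2).

Definition compat17 : Prop := forall x y : V,
  antisym (ΔV (x ∘ y))
  = antisym (\tsum_(x1, x2 <- ΔV x) x1 ⊗ (x2 ∘ y)
             + \tsum_(y1, y2 <- ΔV y) (x ∘ y1) ⊗ y2
             + \tsum_(y1, y2 <- ΔV y) y1 ⊗ (x ∘ y2)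
             + \tsum_(x1, x2 <- γ x) x1 ⊗ (x2 ▷ y)
             + \tsum_(y1, y2 <- ρ y) (x ◁ y1) ⊗ y2
             + \tsum_(y1, y2 <- γ y) y1 ⊗ (x ◁ y2)).

Record extending_compat : Prop := ExtendingCompat {
  ec1 : compat1;   ec2 : compat2;   ec3 : compat3;   ec4 : compat4;
  ec5 : compat5;   ec6 : compat6;   ec7 : compat7;   ec8 : compat8;
  ec9 : compat9;   ec10 : compat10; ec11 : compat11; ec12 : compat12;
  ec13 : compat13; ec14 : compat14; ec15 : compat15; ec16 : compat16;
  ec17 : compat17
}.

End Extending.

Section Homomorphisms.
Variables (F : fieldType) (B C : lmodType F).

Definition algebra_hom (mB : B -> B -> B) (mC : C -> C -> C)
    (f : B -> C) : Prop :=
  linear f /\ forall a b, f (mB a b) = mC (f a) (f b).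

Definition coalgebra_hom (DB : B -> (B ⊗ B)%type) (DC : C -> (C ⊗ C)%type)
    (f : B -> C) : Prop :=
  linear f /\ forall b, DC (f b) = tmap f f (DB b).

End Homomorphisms.

(* Main.v *)
Require Import Defs.
From HB Require Import structures.
From mathcomp Require Import all_boot all_algebra.
From mathcomp Require Import boolp.

(** The tensor square of E = A ⊕ V is the direct sum of the four spaces A ⊗ A,
    V ⊗ A, A ⊗ V and V ⊗ V ([block_proj]), so an identity in E ⊗ E is the
    conjunction of its four components.

    Write the two compatibility axioms of a left-symmetric bialgebra as the
    vanishing of two maps E × E -> E ⊗ E, [comm_defect] and [mul_defect].  Both
    are bilinear, hence vanish as soon as they do on pairs of elements of A or V
    ([bilinear_gen]).  On such a pair the coproducts are explicit blocks, and
    the operators that act on the legs (multiplication by a fixed element of A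
    or V, or bracket with it) preserve V and are therefore block triangular
    ([triangular]); [triangular_tmapl] and [triangular_tmapr] apply them to a
    block.  This computes the components of the defects:
    - for [comm_defect], the pairs in A × A give [compat1], [compat2] and
      [compat6], those in V × A give [compat7], [compat8] and [compat5], those
      in V × V give [compat4], [compat3] and [compat16]; the pairs in A × V
      bring nothing new, because [comm_defect] is antisymmetric;
    - for [mul_defect], the pairs in A × A give [compat9] and [compat13], those
      in A × V give [compat15] and [compat11], those in V × A give [compat14]
      and [compat12], those in V × V give [compat10] and [compat17].  There are
      only two conditions per pair because id - tau has, up to sign and the
      flip, the same component in V ⊗ A and in A ⊗ V.
    The component in A ⊗ A is the defect of A on pairs in A × A and zero on the
    other pairs, so it vanishes when A is a bialgebra.

    Conversely, if the projection to A is a homomorphism for the product and the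
    coproduct of E, the component in A of the product and the component in A ⊗ A
    of the coproduct are those of A; the ten maps of the extending datum are the
    remaining components ([recovered_datum]), and the equivalence applies. *)

Set Implicit Arguments.
Unset Strict Implicit.
Unset Printing Implicit Defensive.

Import GRing.Theory.
Local Open Scope ring_scope.

(** * Linear and bilinear maps *)

Section LinearMaps.
Variables (F : fieldType) (U V W : lmodType F) (f : U -> V).
Hypothesis fl : linear f.

Lemma linfD u v : f (u + v) = f u + f v.
Proof. by have := fl 1 u v; rewrite !scale1r. Qed.

Lemma linf0 : f 0 = 0.
Proof. by apply: (addrI (f 0)); rewrite -linfD !addr0. Qed.

Lemma linfZ c u : f (c *: u) = c *: f u.
Proof. by have := fl c u 0; rewrite linf0 !addr0. Qed.

Lemma linfN u : f (- u) = - f u.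
Proof. by apply: (addrI (f u)); rewrite -linfD !subrr linf0. Qed.

Lemma linfB u v : f (u - v) = f u - f v.
Proof. by rewrite linfD linfN. Qed.

(** Turns a proof of linearity into the bundled form that [extending_datum]
    asks for. *)
Definition pack_linear : {linear U -> V} :=
  HB.pack_for {linear U -> V} f (GRing.isLinear.Build F U V *:%R f fl).

Lemma linear_comp (g : V -> W) : linear g -> linear (fun u => g (f u)).
Proof. by move=> gl c u v; rewrite fl gl. Qed.

Lemma linear_addf (g : U -> V) : linear g -> linear (fun u => f u + g u).
Proof. by move=> gl c u v; rewrite fl gl scalerDr addrACA. Qed.

Lemma linear_subf (g : U -> V) : linear g -> linear (fun u => f u - g u).
Proof. by move=> gl c u v; rewrite fl gl scalerBr opprD addrACA. Qed.

End LinearMaps.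

Lemma linear_id (F : fieldType) (U : lmodType F) : linear (@id U).
Proof. by []. Qed.

Section BilinearMaps.
Variables (F : fieldType) (U V W : lmodType F).
Implicit Types f g : U -> V -> W.

Lemma bilinear_flip f : bilinear_map f -> bilinear_map (fun v u => f u v).
Proof. by case. Qed.

Lemma bilinear_addf f g : bilinear_map f -> bilinear_map g ->
  bilinear_map (fun u v => f u v + g u v).
Proof. by case=> fl fr [gl gr]; split=> z; apply: linear_addf. Qed.

Lemma bilinear_subf f g : bilinear_map f -> bilinear_map g ->
  bilinear_map (fun u v => f u v - g u v).
Proof. by case=> fl fr [gl gr]; split=> z; apply: linear_subf. Qed.

Lemma bilinear_comp (W' : lmodType F) f (h : W -> W') :
  bilinear_map f -> linear h -> bilinear_map (fun u v => h (f u v)).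
Proof. by case=> fl fr hl; split=> z; apply: linear_comp. Qed.

Lemma bilinear_pre (U' V' : lmodType F) f (h : U' -> U) (k : V' -> V) :
  bilinear_map f -> linear h -> linear k ->
  bilinear_map (fun u v => f (h u) (k v)).
Proof.
case=> fl fr hl kl; split=> z; first exact: (linear_comp hl (fl _)).
exact: (linear_comp kl (fr _)).
Qed.

End BilinearMaps.

Lemma bilinear_commutator (F : fieldType) (U : lmodType F)
  (m : U -> U -> U) : bilinear_map m -> bilinear_map (commutator m).
Proof. by move=> mb; apply: bilinear_subf => //; apply: bilinear_flip. Qed.

Lemma bilinear_tens (F : fieldType) (U V W : lmodType F)
  (h : {linear (U ⊗ V)%type -> W}) : bilinear_map (fun u v => h (u ⊗ v)).
Proof.
by apply: bilinear_comp; [apply: tens_bilinear | move=> c u v; rewrite linearP].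
Qed.

(** * Maps between tensor products *)

Section TensorMapTheory.
Variable F : fieldType.

Lemma linear_tsum (U V W W' : lmodType F) (h : W -> W') (f : U -> V -> W) t :
  linear h -> h (tsum f t) = tsum (fun u v => h (f u v)) t.
Proof.
by move=> hl; apply: (big_morph h (linfD hl) (linf0 hl)).
Qed.

Lemma eq_tsum (U V W : lmodType F) (f g : U -> V -> W) t :
  (forall u v, f u v = g u v) -> tsum f t = tsum g t.
Proof. by move=> fg; apply: eq_bigr => p _. Qed.

Section Tens.
Variables U V : lmodType F.

Lemma tens0l (v : V) : (0 : U) ⊗ v = 0.
Proof. exact: (linf0 ((tens_bilinear U V).1 v)). Qed.

Lemma tens0r (u : U) : u ⊗ (0 : V) = 0.
Proof. exact: (linf0 ((tens_bilinear U V).2 u)). Qed.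

Lemma tensDl (u u' : U) (v : V) : (u + u') ⊗ v = u ⊗ v + u' ⊗ v.
Proof. exact: (linfD ((tens_bilinear U V).1 v)). Qed.

Lemma tensDr (u : U) (v v' : V) : u ⊗ (v + v') = u ⊗ v + u ⊗ v'.
Proof. exact: (linfD ((tens_bilinear U V).2 u)). Qed.

Lemma tensBr (u : U) (v v' : V) : u ⊗ (v - v') = u ⊗ v - u ⊗ v'.
Proof. exact: (linfB ((tens_bilinear U V).2 u)). Qed.

Lemma tau_linear : linear (@tau F U V).
Proof. exact/tsum_linear/bilinear_flip/tens_bilinear. Qed.

Lemma tau_tens (u : U) (v : V) : tau (u ⊗ v) = v ⊗ u.
Proof. exact/tsum_tens/bilinear_flip/tens_bilinear. Qed.

End Tens.

Lemma tau_tsum_tens (U V X Y : lmodType F) (f : U -> V -> X)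
    (g : U -> V -> Y) t :
  tau (tsum (fun u v => f u v ⊗ g u v) t) = tsum (fun u v => g u v ⊗ f u v) t.
Proof.
rewrite (linear_tsum _ _ (@tau_linear _ _)).
by apply: eq_tsum => u v; rewrite tau_tens.
Qed.

Section TensorMap.
Variables (U V U' V' : lmodType F).
Implicit Types (f : U -> U') (g : V -> V').

Lemma bilinear_tmap f g :
  linear f -> linear g -> bilinear_map (fun u v => f u ⊗ g v).
Proof. exact/bilinear_pre/tens_bilinear. Qed.

Lemma tmap_linear f g : linear f -> linear g -> linear (tmap f g).
Proof. by move=> fl gl; apply/tsum_linear/bilinear_tmap. Qed.

Lemma tmap_tens f g u v :
  linear f -> linear g -> tmap f g (u ⊗ v) = f u ⊗ g v.
Proof. by move=> fl gl; apply/tsum_tens/bilinear_tmap. Qed.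

Lemma tmap_idid (t : (U ⊗ V)%type) : tmap id id t = t.
Proof. by rewrite [RHS]tensor_repr. Qed.

Lemma eq_tmap f f' g g' t : f =1 f' -> g =1 g' -> tmap f g t = tmap f' g' t.
Proof. by move=> ff' gg'; apply: eq_tsum => u v; rewrite ff' gg'. Qed.

Lemma tmap0l g t : tmap (fun _ : U => 0 : U') g t = 0.
Proof. by apply: big1 => p _; rewrite tens0l. Qed.

Lemma tmap0r f t : tmap f (fun _ : V => 0 : V') t = 0.
Proof. by apply: big1 => p _; rewrite tens0r. Qed.

End TensorMap.

Section Compositions.
Variables (U V U' V' U'' V'' : lmodType F).

(** Only the outer maps have to be linear: the inner ones are evaluated on the
    representative chosen by [tsum]. *)
Lemma tmap_comp (f : U' -> U'') (g : V' -> V'') (f' : U -> U') (g' : V -> V')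
  t : linear f -> linear g ->
  tmap f g (tmap f' g' t) = tmap (fun u => f (f' u)) (fun v => g (g' v)) t.
Proof.
move=> fl gl; rewrite {2}/tmap (linear_tsum _ _ (tmap_linear fl gl)).
by apply: eq_tsum => u v; rewrite tmap_tens.
Qed.

Lemma tmap_tau (f : U -> U') (g : V -> V') t : linear f -> linear g ->
  tmap g f (tau t) = tau (tmap f g t).
Proof.
move=> fl gl; rewrite tau_tsum_tens (linear_tsum _ _ (tmap_linear gl fl)).
by apply: eq_tsum => u v; rewrite tmap_tens.
Qed.

End Compositions.

Section Families.
Variables (U V U' V' P Q : lmodType F).

(** Letting the map of one leg vary with a parameter p yields the bilinear maps
    from which the two defects are built; linearity in p holds term by term in
    the sum over the representative. *)
Lemma bilinear_tmapl (b : P -> U -> U') (h : Q -> (U ⊗ V)%type) :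
  bilinear_map b -> linear h ->
  bilinear_map (fun p q => tmap (b p) (id : V -> V) (h q)).
Proof.
case=> bl br hl; split=> [q c p p'|p]; last first.
  exact: (linear_comp hl (tmap_linear (br p) (@linear_id F V))).
rewrite /tmap /tsum scaler_sumr -big_split; apply: eq_bigr => z _.
by rewrite bl (tens_bilinear U' V).1.
Qed.

Lemma bilinear_tmapr (b : P -> V -> V') (h : Q -> (U ⊗ V)%type) :
  bilinear_map b -> linear h ->
  bilinear_map (fun p q => tmap (id : U -> U) (b p) (h q)).
Proof.
case=> bl br hl; split=> [q c p p'|p]; last first.
  exact: (linear_comp hl (tmap_linear (@linear_id F U) (br p))).
rewrite /tmap /tsum scaler_sumr -big_split; apply: eq_bigr => z _.
by rewrite bl (tens_bilinear U V').2.
Qed.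

End Families.

End TensorMapTheory.

Lemma tsum_tensBr (F : fieldType) (U V X Y : lmodType F) (f : U -> V -> X)
    (g h : U -> V -> Y) t :
  tsum (fun u v => f u v ⊗ (g u v - h u v)) t
  = tsum (fun u v => f u v ⊗ g u v) t - tsum (fun u v => f u v ⊗ h u v) t.
Proof.
by rewrite /tsum -sumrB; apply: eq_bigr => p _; rewrite tensBr.
Qed.

Lemma tauK (F : fieldType) (U V : lmodType F) :
  cancel (@tau F U V) (@tau F V U).
Proof.
move=> t; rewrite -[t in RHS]tmap_idid {2}/tau tau_tsum_tens.
by [].
Qed.

Lemma antisym_linear (F : fieldType) (U : lmodType F) : linear (@antisym F U).
Proof. by apply: linear_subf => //; apply: tau_linear. Qed.

(** * Block decomposition of the tensor square of a direct sum *)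

Section Blocks.
Variables (F : fieldType) (A V : lmodType F).
Local Notation E := (A * V)%type.
Local Notation iA := (@inA F A V).
Local Notation iV := (@inV F A V).

Lemma pair_split (e : E) : e = iA e.1 + iV e.2.
Proof. by case: e => a x; congr pair; rewrite /= ?addr0 ?add0r. Qed.

Lemma inA_linear : linear iA.
Proof. by move=> c a b; congr pair; rewrite /= scaler0 addr0. Qed.

Lemma inV_linear : linear iV.
Proof. by move=> c x y; congr pair; rewrite /= scaler0 addr0. Qed.

Lemma fst_linear : linear (fst : E -> A). Proof. by []. Qed.

Lemma snd_linear : linear (snd : E -> V). Proof. by []. Qed.

(** Reduces the axioms of E to arguments that lie in A or V. *)
Lemma bilinear_gen (W : lmodType F) (g : E -> E -> W) : bilinear_map g ->
  (forall a b, g (iA a) (iA b) = 0) -> (forall a y, g (iA a) (iV y) = 0) ->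
  (forall x b, g (iV x) (iA b) = 0) -> (forall x y, g (iV x) (iV y) = 0) ->
  forall e f, g e f = 0.
Proof.
case=> gl gr gAA gAV gVA gVV e f.
rewrite [e]pair_split [f]pair_split (linfD (gl _)) !(linfD (gr _)).
by rewrite gAA gAV gVA gVV !addr0.
Qed.

(** The components come in the order A ⊗ A, V ⊗ A, A ⊗ V, V ⊗ V. *)
Definition block (s : (A ⊗ A)%type) (u : (V ⊗ A)%type) (v : (A ⊗ V)%type)
    (w : (V ⊗ V)%type) : (E ⊗ E)%type :=
  tmap iA iA s + tmap iV iA u + tmap iA iV v + tmap iV iV w.

(** Both legs are split along e = (e.1, 0) + (0, e.2). *)
Lemma block_proj t :
  t = block (tmap fst fst t) (tmap snd fst t) (tmap fst snd t) (tmap snd snd t).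
Proof.
have lA := inA_linear; have lV := inV_linear.
rewrite /block !tmap_comp // -{1}[t]tmap_idid /tmap /tsum -!big_split.
apply: eq_bigr => -[e f] _; rewrite [LHS]/=.
rewrite [X in X ⊗ _]pair_split [X in _ ⊗ X]pair_split !tensDr !tensDl.
by rewrite !addrA.
Qed.

Section Projections.
Variables (s : (A ⊗ A)%type) (u : (V ⊗ A)%type) (v : (A ⊗ V)%type)
  (w : (V ⊗ V)%type).

Lemma tmap_block (X Y : lmodType F) (p : E -> X) (q : E -> Y) :
  linear p -> linear q ->
  tmap p q (block s u v w)
  = tmap (fun a => p (iA a)) (fun a => q (iA a)) s
    + tmap (fun x => p (iV x)) (fun a => q (iA a)) u
    + tmap (fun a => p (iA a)) (fun x => q (iV x)) v
    + tmap (fun x => p (iV x)) (fun x => q (iV x)) w.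
Proof.
move=> pl ql; rewrite /block !(linfD (tmap_linear pl ql)).
by rewrite !(tmap_comp _ _ _ pl ql).
Qed.

Lemma block_AA : tmap fst fst (block s u v w) = s.
Proof.
rewrite (tmap_block fst_linear fst_linear) /= !(tmap0l, tmap0r) !addr0.
exact: tmap_idid.
Qed.

Lemma block_VA : tmap snd fst (block s u v w) = u.
Proof.
rewrite (tmap_block snd_linear fst_linear) /= !(tmap0l, tmap0r) !addr0 ?add0r.
exact: tmap_idid.
Qed.

Lemma block_AV : tmap fst snd (block s u v w) = v.
Proof.
rewrite (tmap_block fst_linear snd_linear) /= !(tmap0l, tmap0r) !addr0 ?add0r.
exact: tmap_idid.
Qed.

Lemma block_VV : tmap snd snd (block s u v w) = w.
Proof.
rewrite (tmap_block snd_linear snd_linear) /= !(tmap0l, tmap0r) !addr0 ?add0r.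
exact: tmap_idid.
Qed.

End Projections.

Lemma blockD s u v w s' u' v' w' :
  block s u v w + block s' u' v' w' = block (s + s') (u + u') (v + v') (w + w').
Proof.
have lA := inA_linear; have lV := inV_linear.
rewrite /block (linfD (tmap_linear lA lA)) (linfD (tmap_linear lV lA)).
rewrite (linfD (tmap_linear lA lV)) (linfD (tmap_linear lV lV)).
by rewrite (AC (4*4) ((1*5)*(2*6)*(3*7)*(4*8))).
Qed.

Lemma blockN s u v w : - block s u v w = block (- s) (- u) (- v) (- w).
Proof.
have lA := inA_linear; have lV := inV_linear.
rewrite /block (linfN (tmap_linear lA lA)) (linfN (tmap_linear lV lA)).
by rewrite (linfN (tmap_linear lA lV)) (linfN (tmap_linear lV lV)) !opprD.
Qed.

Lemma blockZ c s u v w :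
  c *: block s u v w = block (c *: s) (c *: u) (c *: v) (c *: w).
Proof.
have lA := inA_linear; have lV := inV_linear.
rewrite /block (linfZ (tmap_linear lA lA)) (linfZ (tmap_linear lV lA)).
by rewrite (linfZ (tmap_linear lA lV)) (linfZ (tmap_linear lV lV)) !scalerDr.
Qed.

Lemma block_eq0 s u v w :
  block s u v w = 0 <-> [/\ s = 0, u = 0, v = 0 & w = 0].
Proof.
have lA := inA_linear; have lV := inV_linear.
split=> [bl0|[-> -> -> ->]]; last first.
  rewrite /block (linf0 (tmap_linear lA lA)) (linf0 (tmap_linear lV lA)).
  by rewrite (linf0 (tmap_linear lA lV)) (linf0 (tmap_linear lV lV)) !addr0.
rewrite -(block_AA s u v w) -{2}(block_VA s u v w) -{3}(block_AV s u v w).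
rewrite -{4}(block_VV s u v w) bl0.
by split; apply/linf0/tmap_linear; (exact: fst_linear || exact: snd_linear).
Qed.

Lemma tau_block s u v w :
  tau (block s u v w) = block (tau s) (tau v) (tau u) (tau w).
Proof.
have lA := inA_linear; have lV := inV_linear.
rewrite /block !(linfD (@tau_linear _ _ _)) -!tmap_tau //.
by congr (_ + _); rewrite addrAC.
Qed.

Lemma antisym_block s u v w :
  antisym (block s u v w)
  = block (antisym s) (u - tau v) (v - tau u) (antisym w).
Proof. by rewrite /antisym tau_block blockN blockD. Qed.

(** Endomorphisms of A ⊕ V that preserve V.  Multiplications and brackets by a
    fixed element have this form, because V is an ideal of the extended
    product. *)
Definition triangular (f : E -> E) (f1 : A -> A) (f2 : A -> V) (f3 : V -> V) :=
  [/\ linear f, forall a, f (iA a) = iA (f1 a) + iV (f2 a)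
    & forall x, f (iV x) = iV (f3 x)].

Lemma triangular_sub f f1 f2 f3 g g1 g2 g3 :
  triangular f f1 f2 f3 -> triangular g g1 g2 g3 ->
  triangular (fun e => f e - g e) (fun a => f1 a - g1 a)
    (fun a => f2 a - g2 a) (fun x => f3 x - g3 x).
Proof.
case=> fl fA fV [gl gA gV]; split=> [|a|x]; first exact: linear_subf.
  rewrite fA gA (linfB inA_linear) (linfB inV_linear) opprD.
  exact: addrACA.
by rewrite fV gV (linfB inV_linear).
Qed.

Lemma triangular_tmapl f f1 f2 f3 s u v w : triangular f f1 f2 f3 ->
  tmap f id (block s u v w)
  = block (tmap f1 id s) (tmap f2 id s + tmap f3 id u)
      (tmap f1 id v) (tmap f2 id v + tmap f3 id w).
Proof.
case=> fl fA fV; have lA := inA_linear; have lV := inV_linear.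
have AE (W : lmodType F) (k : W -> E) (z : (A ⊗ W)%type) : linear k ->
    tmap (fun a => f (iA a)) k z
    = tmap iA k (tmap f1 id z) + tmap iV k (tmap f2 id z).
  move=> kl; rewrite !tmap_comp // /tmap /tsum -big_split.
  by apply: eq_bigr => p _; rewrite fA tensDl.
have VE (W : lmodType F) (k : W -> E) (z : (V ⊗ W)%type) : linear k ->
    tmap (fun x => f (iV x)) k z = tmap iV k (tmap f3 id z).
  by move=> kl; rewrite tmap_comp //; apply: eq_tmap.
rewrite tmap_block // !AE // !VE // /block.
rewrite (linfD (tmap_linear lV lA)) (linfD (tmap_linear lV lV)).
by rewrite !addrA.
Qed.

Lemma triangular_tmapr f f1 f2 f3 s u v w : triangular f f1 f2 f3 ->
  tmap id f (block s u v w)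
  = block (tmap id f1 s) (tmap id f1 u)
      (tmap id f2 s + tmap id f3 v) (tmap id f2 u + tmap id f3 w).
Proof.
case=> fl fA fV; have lA := inA_linear; have lV := inV_linear.
have AE (W : lmodType F) (k : W -> E) (z : (W ⊗ A)%type) : linear k ->
    tmap k (fun a => f (iA a)) z
    = tmap k iA (tmap id f1 z) + tmap k iV (tmap id f2 z).
  move=> kl; rewrite !tmap_comp // /tmap /tsum -big_split.
  by apply: eq_bigr => p _; rewrite fA tensDr.
have VE (W : lmodType F) (k : W -> E) (z : (W ⊗ V)%type) : linear k ->
    tmap k (fun x => f (iV x)) z = tmap k iV (tmap id f3 z).
  by move=> kl; rewrite tmap_comp //; apply: eq_tmap.
rewrite tmap_block // !AE // !VE // /block.
rewrite (linfD (tmap_linear lA lV)) (linfD (tmap_linear lV lV)).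
by rewrite (AC ((((2*2)*1)*1)) (1*3*(2*5)*(4*6))).
Qed.

Lemma triangular_linear f f1 f2 f3 :
  triangular f f1 f2 f3 -> linear f1 /\ linear f2.
Proof.
case=> fl fA _; have f12 a : f (iA a) = (f1 a, f2 a).
  by rewrite fA; congr pair; rewrite /= ?addr0 ?add0r.
split=> c a b; first have /(congr1 fst) := f12 (c *: a + b).
  by rewrite inA_linear fl !f12.
by have /(congr1 snd) := f12 (c *: a + b); rewrite inA_linear fl !f12.
Qed.

(** The shape needed for the coproduct of an element of V, which has no
    component in A ⊗ A.  A triangular operator on one leg cannot create one,
    since f1 and f2 inherit linearity from f. *)
Lemma triangular_tmapl0 f f1 f2 f3 u v w : triangular f f1 f2 f3 ->
  tmap f id (block 0 u v w)
  = block 0 (tmap f3 id u) (tmap f1 id v) (tmap f2 id v + tmap f3 id w).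
Proof.
move=> ft; rewrite (triangular_tmapl _ _ _ _ ft).
have [f1l f2l] := triangular_linear ft.
by rewrite !linf0 ?add0r //; apply: tmap_linear.
Qed.

Lemma triangular_tmapr0 f f1 f2 f3 u v w : triangular f f1 f2 f3 ->
  tmap id f (block 0 u v w)
  = block 0 (tmap id f1 u) (tmap id f3 v) (tmap id f2 u + tmap id f3 w).
Proof.
move=> ft; rewrite (triangular_tmapr _ _ _ _ ft).
have [f1l f2l] := triangular_linear ft.
by rewrite !linf0 ?add0r //; apply: tmap_linear.
Qed.

End Blocks.

(** * Compatibility defects *)

Section Defects.
Variables (F : fieldType) (U : lmodType F).
Variables (m : U -> U -> U) (D : U -> (U ⊗ U)%type).

(** The axiom on the coproduct of a bracket says that this coproduct is
    [comm_part a b - comm_part b a]. *)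
Definition comm_part a b : (U ⊗ U)%type :=
  tmap (m a) id (D b) + tmap id (commutator m a) (D b).

Definition mul_part a b : (U ⊗ U)%type :=
  tmap id (m^~ b) (D a) + tmap (m a) id (D b) + tmap id (m a) (D b).

Definition comm_defect a b : (U ⊗ U)%type :=
  D (commutator m a b) - (comm_part a b - comm_part b a).

Definition mul_defect a b : (U ⊗ U)%type :=
  antisym (D (m a b) - mul_part a b).

Lemma bialgebra_defects :
  left_symmetric_bialgebra m D
  <-> [/\ left_symmetric_algebra m, left_symmetric_coalgebra D,
          forall a b, comm_defect a b = 0 & forall a b, mul_defect a b = 0].
Proof.
split=> -[mL DL H1 H2]; split=> // a b.
- apply/eqP; rewrite /comm_defect H1 subr_eq0 opprD addrA.
  exact: eqxx.
- by rewrite /mul_defect (linfB (@antisym_linear _ _)) H2 subrr.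
- by move/eqP: (H1 a b); rewrite /comm_defect subr_eq0 opprD addrA => /eqP ->.
- move/eqP: (H2 a b).
  by rewrite /mul_defect (linfB (@antisym_linear _ _)) subr_eq0 => /eqP.
Qed.

Hypotheses (mb : bilinear_map m) (Dl : linear D).

Lemma comm_defectN a b : comm_defect b a = - comm_defect a b.
Proof.
by rewrite /comm_defect /commutator !(linfB Dl) !opprB addrC.
Qed.

Lemma bilinear_comm_defect : bilinear_map comm_defect.
Proof.
have cb := bilinear_commutator mb.
have Tb : bilinear_map comm_part.
  by apply: bilinear_addf; [apply: bilinear_tmapl | apply: bilinear_tmapr].
apply: bilinear_subf; first exact: bilinear_comp.
by apply: bilinear_subf => //; apply: bilinear_flip.
Qed.

Lemma bilinear_mul_defect : bilinear_map mul_defect.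
Proof.
have Sb : bilinear_map mul_part.
  do 2?apply: bilinear_addf; last exact: bilinear_tmapr.
    exact/bilinear_flip/(bilinear_tmapr (bilinear_flip mb)).
  exact: bilinear_tmapl.
apply: bilinear_comp (@antisym_linear _ _).
by apply: bilinear_subf => //; apply: bilinear_comp.
Qed.

End Defects.

(** * Splitting an identity into its components *)

Lemma forall_and3 (S T : Type) (Q P1 P2 P3 : S -> T -> Prop) :
  (forall a b, Q a b <-> [/\ P1 a b, P2 a b & P3 a b]) ->
  (forall a b, Q a b)
  <-> [/\ forall a b, P1 a b, forall a b, P2 a b & forall a b, P3 a b].
Proof.
move=> QP; split=> [Qab|[p1 p2 p3] a b]; last exact/QP.
by split=> a b; have /QP[] := Qab a b.
Qed.

(** The swapped quantifiers of P3 serve a condition stated for the pair in the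
    opposite order. *)
Lemma forall_and3_swap (S T : Type) (Q P1 P2 : S -> T -> Prop)
    (P3 : T -> S -> Prop) :
  (forall a b, Q a b <-> [/\ P1 a b, P2 a b & P3 b a]) ->
  (forall a b, Q a b)
  <-> [/\ forall a b, P1 a b, forall a b, P2 a b & forall b a, P3 b a].
Proof.
move=> QP; split=> [Qab|[p1 p2 p3] a b]; last exact/QP.
by split=> [a b|a b|b a]; have /QP[] := Qab a b.
Qed.

Lemma forall_and2 (S T : Type) (Q P1 P2 : S -> T -> Prop) :
  (forall a b, Q a b <-> P1 a b /\ P2 a b) ->
  (forall a b, Q a b) <-> (forall a b, P1 a b) /\ (forall a b, P2 a b).
Proof.
move=> QP; split=> [Qab|[p1 p2] a b]; last exact/QP.
by split=> a b; have /QP[] := Qab a b.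
Qed.

Lemma eq_sub_iff (U : zmodType) (l r z : U) : l - r = z -> l = r <-> z = 0.
Proof.
by move=> <-; split=> [->|/eqP]; rewrite ?subrr // subr_eq0 => /eqP.
Qed.

Lemma block_eq0_iff (F : fieldType) (A V : lmodType F)
    (s : (A ⊗ A)%type) (u : (V ⊗ A)%type) (v : (A ⊗ V)%type)
    (w : (V ⊗ V)%type) (P1 P2 P3 : Prop) :
  s = 0 -> P1 <-> u = 0 -> P2 <-> v = 0 -> P3 <-> w = 0 ->
  block s u v w = 0 <-> [/\ P1, P2 & P3].
Proof.
move=> s0 p1 p2 p3; rewrite block_eq0.
by split=> [[_ /p1 ? /p2 ? /p3 ?]|[/p1 ? /p2 ? /p3 ?]].
Qed.

Lemma antisym_sub_iff (F : fieldType) (U : lmodType F)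
    (l r z : (U ⊗ U)%type) :
  l - r = z -> antisym l = antisym r <-> antisym z = 0.
Proof.
by move=> <-; rewrite (linfB (@antisym_linear F U)); apply: eq_sub_iff.
Qed.

(** The components of id - tau in V ⊗ A and A ⊗ V determine each other, so one
    equation is enough for both; the two lemmas differ in the component in which
    it is written. *)
Lemma antisym_block_VA_iff (F : fieldType) (A V : lmodType F)
    (s : (A ⊗ A)%type) (u : (V ⊗ A)%type) (v : (A ⊗ V)%type)
    (w : (V ⊗ V)%type) (P1 P2 : Prop) :
  antisym s = 0 -> P1 <-> u - tau v = 0 -> P2 <-> antisym w = 0 ->
  antisym (block s u v w) = 0 <-> P1 /\ P2.
Proof.
move=> s0 p1 p2; rewrite antisym_block block_eq0.
split=> [[_ /p1 ? _ /p2 ?]|[/p1 u0 /p2 ?]] //; split=> //.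
by move/eqP: u0; rewrite subr_eq0 => /eqP ->; rewrite tauK subrr.
Qed.

Lemma antisym_block_AV_iff (F : fieldType) (A V : lmodType F)
    (s : (A ⊗ A)%type) (u : (V ⊗ A)%type) (v : (A ⊗ V)%type)
    (w : (V ⊗ V)%type) (P1 P2 : Prop) :
  antisym s = 0 -> P1 <-> v - tau u = 0 -> P2 <-> antisym w = 0 ->
  antisym (block s u v w) = 0 <-> P1 /\ P2.
Proof.
move=> s0 p1 p2; rewrite antisym_block block_eq0.
split=> [[_ _ /p1 ? /p2 ?]|[/p1 v0 /p2 ?]] //; split=> //.
by move/eqP: v0; rewrite subr_eq0 => /eqP ->; rewrite tauK subrr.
Qed.

(** Proves an identity between signed sums of [tsum] terms that holds up to
    distributivity and a permutation: everything is expanded into atoms, the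
    [tsum] atoms are generalized to keep the matching syntactic, and each atom
    on the left is pulled to the front on the right and cancelled.  The trailing
    zeros ensure that every atom is followed by another summand, as [addrCA]
    requires. *)
Ltac zmod_eq :=
  rewrite /tmap /commutator /id ?tsum_tensBr
    ?(linearB (DeltaV _), linearB (gamma _), linearB (rho _));
  rewrite ?(linfD (@tau_linear _ _ _), linfN (@tau_linear _ _ _));
  rewrite ?tau_tsum_tens;
  rewrite ?(opprD, opprK); rewrite -[LHS]addr0 -[RHS]addr0 -?addrA;
  repeat match goal with |- context[tsum ?f ?t] =>
    let z := fresh "z" in move: (tsum f t) => z end;
  repeat lazymatch goal with |- ?x + _ = _ =>
    rewrite ?[in RHS](addrCA _ x); congr (_ + _) end.

(** * The extended product and coproduct in blocks *)

Section Extended.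
Variables (F : fieldType) (A V : lmodType F).
Variables (m : A -> A -> A) (D : A -> (A ⊗ A)%type).
Variable d : extending_datum A V.
Hypotheses (mb : bilinear_map m) (Dl : linear D).

Local Notation E := (A * V)%type.
Local Notation iA := (@inA F A V).
Local Notation iV := (@inV F A V).
Local Notation mE := (extended_mul m d).
Local Notation DE := (extended_comul D d).

(* A prime marks the map in which the other argument varies. *)
Local Notation la a := (fun x => lact d (a ⊗ x)).
Local Notation la' x := (fun a => lact d (a ⊗ x)).
Local Notation ra x := (fun a => ract d (x ⊗ a)).
Local Notation ra' a := (fun x => ract d (x ⊗ a)).
Local Notation th a := (fun b => cocycle d (a ⊗ b)).
Local Notation th' b := (fun a => cocycle d (a ⊗ b)).
Local Notation mv x := (fun y => mulV d (x ⊗ y)).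
Local Notation mv' y := (fun x => mulV d (x ⊗ y)).
Local Notation ad a := (commutator m a).
Local Notation lad a := (fun x => lact d (a ⊗ x) - ract d (x ⊗ a)).
Local Notation rad x := (fun a => ract d (x ⊗ a) - lact d (a ⊗ x)).
Local Notation tad a := (fun b => cocycle d (a ⊗ b) - cocycle d (b ⊗ a)).
Local Notation vad x := (fun y => mulV d (x ⊗ y) - mulV d (y ⊗ x)).
Local Notation φ := (phi d).
Local Notation ψ := (psi d).
Local Notation ρ := (rho d).
Local Notation γ := (gamma d).
Local Notation P := (cococycle d).
Local Notation ΔV := (DeltaV d).

Lemma extended_mul_bilinear : bilinear_map mE.
Proof.
have [ml mr] := mb.
have [lal lar] := bilinear_tens (lact d).
have [ral rar] := bilinear_tens (ract d).
have [thl thr] := bilinear_tens (cocycle d).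
have [mvl mvr] := bilinear_tens (mulV d).
split=> [f c e e'|e c f f']; congr pair; first exact: ml; last 1 first.
- rewrite /= mvr lar rar thr !scalerDr.
  by rewrite (AC ((2*2)*2*2) ((1*3*5*7)*(2*4*6*8))).
- rewrite /= mvl lal ral thl !scalerDr.
  by rewrite (AC ((2*2)*2*2) ((1*3*5*7)*(2*4*6*8))).
exact: mr.
Qed.

Lemma extended_comul_block e :
  DE e = block (D e.1) (φ e.1 + γ e.2) (ψ e.1 + ρ e.2) (P e.1 + ΔV e.2).
Proof.
have lA := @inA_linear F A V; have lV := @inV_linear F A V.
rewrite /extended_comul /block (linfD (tmap_linear lV lA)).
rewrite (linfD (tmap_linear lA lV)) (linfD (tmap_linear lV lV)).
by rewrite (AC (4*3) (1*(2*7)*(3*6)*(4*5))).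
Qed.

Lemma extended_comul_linear : linear DE.
Proof.
move=> c e f; rewrite !extended_comul_block.
rewrite blockZ blockD /= Dl !linearP !scalerDr.
by congr block; rewrite addrACA.
Qed.

Lemma extended_comul_inA a : DE (iA a) = block (D a) (φ a) (ψ a) (P a).
Proof. by rewrite extended_comul_block /= !linear0 !addr0. Qed.

Lemma extended_comul_inV x : DE (iV x) = block 0 (γ x) (ρ x) (ΔV x).
Proof. by rewrite extended_comul_block /= (linf0 Dl) !linear0 !add0r. Qed.

Let mul0l b : m 0 b = 0. Proof. exact: linf0 (mb.1 b). Qed.
Let mul0r a : m a 0 = 0. Proof. exact: linf0 (mb.2 a). Qed.
Let zero_terms := (tens0l, tens0r, linear0, mul0l, mul0r, addr0, add0r).

Lemma extended_mul_AA a b :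
  mE (iA a) (iA b) = iA (m a b) + iV (cocycle d (a ⊗ b)).
Proof. by congr pair; rewrite /= !zero_terms. Qed.

Lemma extended_mul_AV a y : mE (iA a) (iV y) = iV (lact d (a ⊗ y)).
Proof. by congr pair; rewrite /= !zero_terms. Qed.

Lemma extended_mul_VA x b : mE (iV x) (iA b) = iV (ract d (x ⊗ b)).
Proof. by congr pair; rewrite /= !zero_terms. Qed.

Lemma extended_mul_VV x y : mE (iV x) (iV y) = iV (mulV d (x ⊗ y)).
Proof. by congr pair; rewrite /= !zero_terms. Qed.

Definition extended_mulE :=
  (extended_mul_AA, extended_mul_AV, extended_mul_VA, extended_mul_VV).

Lemma commutator_AA a b : commutator mE (iA a) (iA b)
  = iA (commutator m a b) + iV (cocycle d (a ⊗ b) - cocycle d (b ⊗ a)).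
Proof.
rewrite /commutator !extended_mulE opprD addrACA.
by rewrite (linfB (@inA_linear F A V)) (linfB (@inV_linear F A V)).
Qed.

Lemma comul_commutator_AA a b : DE (commutator mE (iA a) (iA b))
  = block (D (commutator m a b))
      (φ (commutator m a b) + γ (cocycle d (a ⊗ b) - cocycle d (b ⊗ a)))
      (ψ (commutator m a b) + ρ (cocycle d (a ⊗ b) - cocycle d (b ⊗ a)))
      (P (commutator m a b) + ΔV (cocycle d (a ⊗ b) - cocycle d (b ⊗ a))).
Proof. by rewrite commutator_AA extended_comul_block /= addr0 add0r. Qed.

Lemma inA0_add (z : E) : iA 0 + z = z.
Proof. by rewrite (linf0 (@inA_linear F A V)) add0r. Qed.

Lemma lmul_inA a : triangular (mE (iA a)) (m a) (th a) (la a).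
Proof.
split=> [|b|y]; [exact: extended_mul_bilinear.2 | exact: extended_mul_AA |].
exact: extended_mul_AV.
Qed.

Lemma lmul_inV x : triangular (mE (iV x)) (fun=> 0) (ra x) (mv x).
Proof.
split=> [|b|y]; first exact: extended_mul_bilinear.2.
  by rewrite inA0_add extended_mul_VA.
exact: extended_mul_VV.
Qed.

Lemma rmul_inA b : triangular (mE^~ (iA b)) (m^~ b) (th' b) (ra' b).
Proof.
split=> [|a|x]; [exact: extended_mul_bilinear.1 | exact: extended_mul_AA |].
exact: extended_mul_VA.
Qed.

Lemma rmul_inV y : triangular (mE^~ (iV y)) (fun=> 0) (la' y) (mv' y).
Proof.
split=> [|a|x]; first exact: extended_mul_bilinear.1.
  by rewrite inA0_add extended_mul_AV.
exact: extended_mul_VV.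
Qed.

Lemma comm_inA a : triangular (commutator mE (iA a)) (ad a) (tad a) (lad a).
Proof. exact: triangular_sub (lmul_inA a) (rmul_inA a). Qed.

Lemma comm_inV x : triangular (commutator mE (iV x)) (fun=> 0) (rad x) (vad x).
Proof.
have := triangular_sub (lmul_inV x) (rmul_inV x).
suff -> : (fun _ : A => 0 - 0) = (fun=> 0) :> (A -> A) by [].
by apply/funext => a; rewrite subr0.
Qed.

(** * The two axioms on pairs of elements of A or V *)

Lemma comm_part_AA a b :
  comm_part mE DE (iA a) (iA b)
  = block (comm_part m D a b)
      (tmap (th a) id (D b) + tmap (la a) id (φ b) + tmap id (ad a) (φ b))
      (tmap (m a) id (ψ b) + (tmap id (tad a) (D b) + tmap id (lad a) (ψ b)))
      (tmap (th a) id (ψ b) + tmap (la a) id (P b)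
       + (tmap id (tad a) (φ b) + tmap id (lad a) (P b))).
Proof.
rewrite /comm_part extended_comul_inA (triangular_tmapl _ _ _ _ (lmul_inA a)).
by rewrite (triangular_tmapr _ _ _ _ (comm_inA a)) blockD.
Qed.

Lemma comm_part_AV a y :
  comm_part mE DE (iA a) (iV y)
  = block 0
      (tmap (la a) id (γ y) + tmap id (ad a) (γ y))
      (tmap (m a) id (ρ y) + tmap id (lad a) (ρ y))
      (tmap (th a) id (ρ y) + tmap (la a) id (ΔV y)
       + (tmap id (tad a) (γ y) + tmap id (lad a) (ΔV y))).
Proof.
rewrite /comm_part extended_comul_inV (triangular_tmapl0 _ _ _ (lmul_inA a)).
by rewrite (triangular_tmapr0 _ _ _ (comm_inA a)) blockD addr0.
Qed.

Lemma comm_part_VA x b :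
  comm_part mE DE (iV x) (iA b)
  = block 0
      (tmap (ra x) id (D b) + tmap (mv x) id (φ b))
      (tmap id (rad x) (D b) + tmap id (vad x) (ψ b))
      (tmap (ra x) id (ψ b) + tmap (mv x) id (P b)
       + (tmap id (rad x) (φ b) + tmap id (vad x) (P b))).
Proof.
rewrite /comm_part extended_comul_inA (triangular_tmapl _ _ _ _ (lmul_inV x)).
rewrite (triangular_tmapr _ _ _ _ (comm_inV x)) blockD.
by rewrite !(tmap0l, tmap0r) !(addr0, add0r).
Qed.

Lemma comm_part_VV x y :
  comm_part mE DE (iV x) (iV y)
  = block 0 (tmap (mv x) id (γ y)) (tmap id (vad x) (ρ y))
      (tmap (ra x) id (ρ y) + tmap (mv x) id (ΔV y)
       + (tmap id (rad x) (γ y) + tmap id (vad x) (ΔV y))).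
Proof.
rewrite /comm_part extended_comul_inV (triangular_tmapl0 _ _ _ (lmul_inV x)).
rewrite (triangular_tmapr0 _ _ _ (comm_inV x)) blockD.
by rewrite !(tmap0l, tmap0r) !(addr0, add0r).
Qed.

Lemma mul_part_AA a b :
  mul_part mE DE (iA a) (iA b)
  = block (mul_part m D a b)
      (tmap id (m^~ b) (φ a) + (tmap (th a) id (D b) + tmap (la a) id (φ b))
       + tmap id (m a) (φ b))
      (tmap id (th' b) (D a) + tmap id (ra' b) (ψ a) + tmap (m a) id (ψ b)
       + (tmap id (th a) (D b) + tmap id (la a) (ψ b)))
      (tmap id (th' b) (φ a) + tmap id (ra' b) (P a)
       + (tmap (th a) id (ψ b) + tmap (la a) id (P b))
       + (tmap id (th a) (φ b) + tmap id (la a) (P b))).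
Proof.
rewrite /mul_part !extended_comul_inA (triangular_tmapr _ _ _ _ (rmul_inA b)).
rewrite (triangular_tmapl _ _ _ _ (lmul_inA a)).
by rewrite (triangular_tmapr _ _ _ _ (lmul_inA a)) !blockD.
Qed.

Lemma mul_part_AV a y :
  mul_part mE DE (iA a) (iV y)
  = block 0
      (tmap (la a) id (γ y) + tmap id (m a) (γ y))
      (tmap id (la' y) (D a) + tmap id (mv' y) (ψ a) + tmap (m a) id (ρ y)
       + tmap id (la a) (ρ y))
      (tmap id (la' y) (φ a) + tmap id (mv' y) (P a)
       + (tmap (th a) id (ρ y) + tmap (la a) id (ΔV y))
       + (tmap id (th a) (γ y) + tmap id (la a) (ΔV y))).
Proof.
rewrite /mul_part extended_comul_inA extended_comul_inV.
rewrite (triangular_tmapr _ _ _ _ (rmul_inV y)).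
rewrite (triangular_tmapl0 _ _ _ (lmul_inA a)).
rewrite (triangular_tmapr0 _ _ _ (lmul_inA a)) !blockD.
by rewrite !tmap0r !(addr0, add0r).
Qed.

Lemma mul_part_VA x b :
  mul_part mE DE (iV x) (iA b)
  = block 0
      (tmap id (m^~ b) (γ x) + (tmap (ra x) id (D b) + tmap (mv x) id (φ b)))
      (tmap id (ra' b) (ρ x)
       + (tmap id (ra x) (D b) + tmap id (mv x) (ψ b)))
      (tmap id (th' b) (γ x) + tmap id (ra' b) (ΔV x)
       + (tmap (ra x) id (ψ b) + tmap (mv x) id (P b))
       + (tmap id (ra x) (φ b) + tmap id (mv x) (P b))).
Proof.
rewrite /mul_part extended_comul_inA extended_comul_inV.
rewrite (triangular_tmapr0 _ _ _ (rmul_inA b)).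
rewrite (triangular_tmapl _ _ _ _ (lmul_inV x)).
rewrite (triangular_tmapr _ _ _ _ (lmul_inV x)) !blockD.
by rewrite !(tmap0l, tmap0r) !(addr0, add0r).
Qed.

Lemma mul_part_VV x y :
  mul_part mE DE (iV x) (iV y)
  = block 0 (tmap (mv x) id (γ y))
      (tmap id (mv' y) (ρ x) + tmap id (mv x) (ρ y))
      (tmap id (la' y) (γ x) + tmap id (mv' y) (ΔV x)
       + (tmap (ra x) id (ρ y) + tmap (mv x) id (ΔV y))
       + (tmap id (ra x) (γ y) + tmap id (mv x) (ΔV y))).
Proof.
rewrite /mul_part !extended_comul_inV.
rewrite (triangular_tmapr0 _ _ _ (rmul_inV y)).
rewrite (triangular_tmapl0 _ _ _ (lmul_inV x)).
rewrite (triangular_tmapr0 _ _ _ (lmul_inV x)) !blockD.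
by rewrite !(tmap0l, tmap0r) !(addr0, add0r).
Qed.

Lemma comm_defect_AA_eq0 :
  (forall a b, comm_defect m D a b = 0) ->
  (forall a b, comm_defect mE DE (iA a) (iA b) = 0)
  <-> [/\ compat1 m D d, compat2 m D d & compat6 m d].
Proof.
move=> m0; apply: forall_and3 => a b.
(* Only the defect of E is unfolded: the first component of the result is the
   defect of A, which vanishes by m0. *)
rewrite {1}/comm_defect comul_commutator_AA.
rewrite !comm_part_AA !(blockN, blockD) -/(comm_defect m D a b).
apply: block_eq0_iff => //; apply: eq_sub_iff.
- by zmod_eq.
- by zmod_eq.
- by zmod_eq.
Qed.

Lemma comm_defect_VA_eq0 :
  (forall x b, comm_defect mE DE (iV x) (iA b) = 0)
  <-> [/\ compat7 m D d, compat8 m D d & compat5 d].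
Proof.
apply: forall_and3_swap => x b.
rewrite /comm_defect /commutator !extended_mulE -(linfB (@inV_linear F A V)).
rewrite extended_comul_inV comm_part_VA comm_part_AV !(blockN, blockD).
apply: block_eq0_iff; first by rewrite !subr0.
- by apply: eq_sub_iff; zmod_eq.
- by apply: eq_sub_iff; zmod_eq.
(* compat5 describes the bracket [b, x], the opposite of the one expanded
   here, hence the symmetry. *)
- by rewrite (rwP eqP) eq_sym -(rwP eqP); apply: eq_sub_iff; zmod_eq.
Qed.

Lemma comm_defect_VV_eq0 :
  (forall x y, comm_defect mE DE (iV x) (iV y) = 0)
  <-> [/\ compat4 d, compat3 d & compat16 d].
Proof.
apply: forall_and3 => x y.
rewrite /comm_defect /commutator !extended_mulE -(linfB (@inV_linear F A V)).
rewrite extended_comul_inV !comm_part_VV !(blockN, blockD).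
apply: block_eq0_iff; first by rewrite !subr0.
- by apply: eq_sub_iff; zmod_eq.
- by apply: eq_sub_iff; zmod_eq.
- by apply: eq_sub_iff; zmod_eq.
Qed.

Lemma mul_defect_AA_eq0 :
  (forall a b, mul_defect m D a b = 0) ->
  (forall a b, mul_defect mE DE (iA a) (iA b) = 0)
  <-> compat9 m D d /\ compat13 m d.
Proof.
move=> m0; apply: forall_and2 => a b.
rewrite {1}/mul_defect extended_mul_AA (linfD extended_comul_linear).
rewrite extended_comul_inA extended_comul_inV mul_part_AA !(blockN, blockD).
apply: antisym_block_VA_iff; first by rewrite addr0; apply: m0.
- by apply: eq_sub_iff; zmod_eq.
- by apply: antisym_sub_iff; zmod_eq.
Qed.

Lemma mul_defect_AV_eq0 :
  (forall a y, mul_defect mE DE (iA a) (iV y) = 0)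
  <-> compat15 m D d /\ compat11 d.
Proof.
apply: forall_and2 => a y.
rewrite /mul_defect extended_mul_AV extended_comul_inV mul_part_AV.
rewrite !(blockN, blockD).
apply: antisym_block_AV_iff.
- by rewrite subr0 (linf0 (@antisym_linear _ _)).
- by apply: eq_sub_iff; zmod_eq.
- by apply: antisym_sub_iff; zmod_eq.
Qed.

Lemma mul_defect_VA_eq0 :
  (forall x b, mul_defect mE DE (iV x) (iA b) = 0)
  <-> compat14 m D d /\ compat12 d.
Proof.
apply: forall_and2 => x b.
rewrite /mul_defect extended_mul_VA extended_comul_inV mul_part_VA.
rewrite !(blockN, blockD).
apply: antisym_block_VA_iff.
- by rewrite subr0 (linf0 (@antisym_linear _ _)).
- by apply: eq_sub_iff; zmod_eq.
- by apply: antisym_sub_iff; zmod_eq.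
Qed.

Lemma mul_defect_VV_eq0 :
  (forall x y, mul_defect mE DE (iV x) (iV y) = 0)
  <-> compat10 d /\ compat17 d.
Proof.
apply: forall_and2 => x y.
rewrite /mul_defect extended_mul_VV extended_comul_inV mul_part_VV.
rewrite !(blockN, blockD).
apply: antisym_block_AV_iff.
- by rewrite subr0 (linf0 (@antisym_linear _ _)).
- by apply: eq_sub_iff; zmod_eq.
- by apply: antisym_sub_iff; zmod_eq.
Qed.

(** Both defects of E are bilinear, so their vanishing is tested on pairs of
    elements of A or V, where it amounts to the compatibility conditions. *)
Lemma bialgebra_iff_compat : left_symmetric_bialgebra m D ->
  left_symmetric_bialgebra mE DE
  <-> [/\ left_symmetric_algebra mE, left_symmetric_coalgebra DE
        & extending_compat m D d].
Proof.
move=> /bialgebra_defects[_ _ c0 m0]; rewrite bialgebra_defects.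
have cE := bilinear_comm_defect extended_mul_bilinear extended_comul_linear.
have sE := bilinear_mul_defect extended_mul_bilinear extended_comul_linear.
split=> [[LE CE cE0 sE0]|[LE CE [*]]]; last first.
  have cVA : forall x b, comm_defect mE DE (iV x) (iA b) = 0.
    exact/comm_defect_VA_eq0.
  split=> //; apply: bilinear_gen => //.
  - exact/(comm_defect_AA_eq0 c0).
  - by move=> a y; rewrite (comm_defectN _ extended_comul_linear) cVA oppr0.
  - exact/comm_defect_VV_eq0.
  - exact/(mul_defect_AA_eq0 m0).
  - exact/mul_defect_AV_eq0.
  - exact/mul_defect_VA_eq0.
  - exact/mul_defect_VV_eq0.
split=> //.
have [c1 c2 c6] := (comm_defect_AA_eq0 c0).1 (fun a b => cE0 _ _).
have [c7 c8 c5] := comm_defect_VA_eq0.1 (fun x b => cE0 _ _).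
have [c4 c3 c16] := comm_defect_VV_eq0.1 (fun x y => cE0 _ _).
have [c9 c13] := (mul_defect_AA_eq0 m0).1 (fun a b => sE0 _ _).
have [c15 c11] := mul_defect_AV_eq0.1 (fun a y => sE0 _ _).
have [c14 c12] := mul_defect_VA_eq0.1 (fun x b => sE0 _ _).
by have [c10 c17] := mul_defect_VV_eq0.1 (fun x y => sE0 _ _).
Qed.

End Extended.

(** * Recovering the extending datum *)

Section Recover.
Variables (F : fieldType) (A V : lmodType F).
Local Notation E := (A * V)%type.
Local Notation iA := (@inA F A V).
Local Notation iV := (@inV F A V).
Variables (mE : E -> E -> E) (DE : E -> (E ⊗ E)%type).
Hypotheses (mEb : bilinear_map mE) (DEl : linear DE).

Definition mul_component (X Y : lmodType F) (i : X -> E) (j : Y -> E)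
    (il : linear i) (jl : linear j) : {linear (X ⊗ Y)%type -> V} :=
  pack_linear (tsum_linear
    (bilinear_comp (bilinear_pre mEb il jl) (@snd_linear F A V))).

Definition comul_component (X Y Z : lmodType F) (i : X -> E) (p : E -> Y)
    (q : E -> Z) (il : linear i) (pl : linear p) (ql : linear q) :
    {linear X -> (Y ⊗ Z)%type} :=
  pack_linear (linear_comp (linear_comp il DEl) (tmap_linear pl ql)).

Let iAl := @inA_linear F A V.
Let iVl := @inV_linear F A V.
Let p1l := @fst_linear F A V.
Let p2l := @snd_linear F A V.

Definition recovered_datum : extending_datum A V := {|
  lact := mul_component iAl iVl;
  ract := mul_component iVl iAl;
  cocycle := mul_component iAl iAl;
  mulV := mul_component iVl iVl;
  phi := comul_component iAl p2l p1l;
  psi := comul_component iAl p1l p2l;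
  rho := comul_component iVl p1l p2l;
  gamma := comul_component iVl p2l p1l;
  cococycle := comul_component iAl p2l p2l;
  DeltaV := comul_component iVl p2l p2l |}.

Lemma mul_component_tens (X Y : lmodType F) (i : X -> E) (j : Y -> E)
    (il : linear i) (jl : linear j) x y :
  mul_component il jl (x ⊗ y) = (mE (i x) (j y)).2.
Proof.
apply: tsum_tens; apply: bilinear_comp (@snd_linear F A V).
exact: (bilinear_pre mEb il jl).
Qed.

Lemma recovered_mul m : algebra_hom mE m fst ->
  mE = extended_mul m recovered_datum.
Proof.
case=> _ pm; apply/funext => e; apply/funext => f.
rewrite [LHS]surjective_pairing pm; congr pair.
have lE a x : lact recovered_datum (a ⊗ x) = (mE (iA a) (iV x)).2.
  exact: (mul_component_tens iAl iVl).
have rE x a : ract recovered_datum (x ⊗ a) = (mE (iV x) (iA a)).2.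
  exact: (mul_component_tens iVl iAl).
have thE a b : cocycle recovered_datum (a ⊗ b) = (mE (iA a) (iA b)).2.
  exact: (mul_component_tens iAl iAl).
have vE x y : mulV recovered_datum (x ⊗ y) = (mE (iV x) (iV y)).2.
  exact: (mul_component_tens iVl iVl).
rewrite lE rE thE vE {1}[e]pair_split {1}[f]pair_split.
rewrite (linfD (mEb.1 _)) !(linfD (mEb.2 _)) /=.
by rewrite (AC (2*2) (4*2*3*1)).
Qed.

Lemma recovered_comul D : coalgebra_hom DE D fst ->
  DE = extended_comul D recovered_datum.
Proof.
case=> _ pD; apply/funext => e.
rewrite extended_comul_block [LHS]block_proj -pD.
by rewrite {2 3 4}[e]pair_split (linfD DEl) !(linfD (tmap_linear _ _)).
Qed.

End Recover.

Theorem theorem5p15 (F : fieldType) (charF0 : [pchar F] =i pred0)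
    (A V : lmodType F) (m : A -> A -> A) (D : A -> (A ⊗ A)%type)
    (bialgA : left_symmetric_bialgebra m D) :
  (forall d : extending_datum A V,
     left_symmetric_bialgebra (extended_mul m d) (extended_comul D d)
     <-> [/\ left_symmetric_algebra (extended_mul m d),
             left_symmetric_coalgebra (extended_comul D d)
           & extending_compat m D d])
  /\
  (forall (mE : A * V -> A * V -> A * V)
          (DE : A * V -> ((A * V)%type ⊗ (A * V)%type)%type),
     left_symmetric_bialgebra mE DE ->
     algebra_hom mE m fst -> coalgebra_hom DE D fst ->
     exists d : extending_datum A V,
       [/\ forall e f, mE e f = extended_mul m d e f,
           forall e, DE e = extended_comul D d e
         & [/\ left_symmetric_algebra (extended_mul m d),
               left_symmetric_coalgebra (extended_comul D d)
             & extending_compat m D d]]).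
Proof.
have [[mb _] [Dl _] _ _] := bialgA.
have bialgE d := bialgebra_iff_compat d mb Dl bialgA.
split=> // mE DE EB pm pD.
have [[mEb _] [DEl _] _ _] := EB.
have [d [mEE DEE]] : exists d,
    mE = extended_mul m d /\ DE = extended_comul D d.
  exists (recovered_datum mEb DEl).
  by split; [apply: recovered_mul | apply: recovered_comul].
exists d; rewrite -mEE -DEE; split=> //.
by rewrite mEE DEE; apply/bialgE; rewrite -mEE -DEE.
Qed.
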